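(* Let $p(\cdot)\ge q(\cdot)$ be log-Hölder continuous exponents on $[0,1]$ with $p^+<\infty$. The following are equivalent: (1) $\operatorname{ess\,inf}\,(p(\cdot)-q(\cdot))>0$. (2) The inclusion $L^{p(\cdot)}[0,1]\hookrightarrow L^{q(\cdot)}[0,1]$ is disjointly strictly singular. (3) $\lim_{x\to1^-}(1-x)^{(p-q)^*(x)}=0$.
   Context: $[0,1]$ carries Lebesgue measure $|\cdot|$. An exponent on $[0,1]$ is a real measurable function $p$ with $1\le p(t)<\infty$; $p^+$ is its essential supremum. A function $f$ on $[0,1]$ is log-Hölder continuous if there is a constant $C>0$ such that $|f(x)-f(y)|\le \frac{C}{\ln\left(e+\frac{1}{|x-y|}\right)}$ for all $x\ne y$ in $[0,1]$. The variable Lebesgue space $L^{p(\cdot)}[0,1]$ is the space of all (classes of) real measurable $f$ such that $\rho_{p(\cdot)}(f/r)<\infty$ for some $r>0$, where $\rho_{p(\cdot)}(f)=\int_0^1 |f(t)|^{p(t)}dt$, with the Luxemburg norm $\|f\|_{p(\cdot)}=\inf\{r>0:\rho_{p(\cdot)}(f/r)\le 1\}$. If $q(\cdot)\le p(\cdot)$ then $L^{p(\cdot)}[0,1]\subset L^{q(\cdot)}[0,1]$ with continuous inclusion. The decreasing rearrangement of a measurable $f$ is $f^*(x)=\inf\{s\in[0,\infty):|\{t\in[0,1]:|f(t)|>s\}|\le x\}$ for $x\in[0,1)$. An operator $T:E\to F$ from a Banach lattice $E$ to a Banach space $F$ is disjointly strictly singular (DSS) if there is no normalized pairwise disjoint sequence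 $(f_n)$ in $E$ such that the restriction of $T$ to the closed linear span $[f_n]$ is an isomorphism onto its image. *)

(* Defs.v *)
From HB Require Import structures.
From mathcomp Require Import all_boot all_order all_algebra.
From mathcomp Require Import all_classical all_reals all_analysis.
From mathcomp Require Import ess_sup_inf.

Set Implicit Arguments.
Unset Strict Implicit.
Unset Printing Implicit Defensive.

Import Order.TTheory GRing.Theory Num.Theory.
Import numFieldNormedType.Exports.

Local Open Scope classical_set_scope.
Local Open Scope ring_scope.

(* A function on [0,1] is represented by a total function R -> R whose values
   outside [0,1] are never used.  Elements of the variable Lebesgue space are
   represented by functions rather than by classes: equality almost everywhere
   is the kernel of the Luxemburg seminorm, so norms, closed spans and
   isomorphisms onto the image are computed on representatives. *)

Section Operators.
Context {K : realType} {V W : lmodType K}.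

Definition linear_span (f : nat -> V) : set V :=
  [set v | exists n (a : nat -> K), v = \sum_(i < n) a i *: f i].

Definition closed_linear_span (E : set V) (nE : V -> K) (f : nat -> V)
    : set V :=
  [set v | E v /\
    forall e, 0 < e -> exists2 w, linear_span f w & nE (v - w) < e].

Definition bounded_operator (E : set V) (nE : V -> K) (F : set W)
    (nF : W -> K) (T : {linear V -> W}) :=
  (forall v, E v -> F (T v)) /\
  exists C : K, forall v, E v -> nF (T v) <= C * nE v.

Definition isomorphism_onto_image (X : set V) (nE : V -> K) (nF : W -> K)
    (T : {linear V -> W}) :=
  exists c C : K, [/\ 0 < c, 0 < C &
    forall v, X v -> c * nE v <= nF (T v) <= C * nE v].

(* [disj] is the disjointness relation of the lattice [E]. *)
Definition disjointly_strictly_singular (E : set V) (nE : V -> K)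
    (disj : V -> V -> Prop) (F : set W) (nF : W -> K)
    (T : {linear V -> W}) :=
  bounded_operator E nE F nF T /\
  ~ exists f : nat -> V,
    [/\ forall n, E (f n) /\ nE (f n) = 1,
        forall m n, m <> n -> disj (f m) (f n) &
        isomorphism_onto_image (closed_linear_span E nE f) nE nF T].

End Operators.

Section VariableLebesgue.
Context {R : realType}.
Implicit Types p f g : R -> R^o.

Definition I01 : set R := `[0, 1]%classic.

Definition leb01 : {measure set (measurableTypeR R) -> \bar R} :=
  mrestr (@lebesgue_measure R) (measurable_itv `[(0 : R), 1]).

Definition exponent p :=
  measurable_fun I01 (p : R -> R) /\ forall t, I01 t -> 1 <= p t.

Definition log_holder f := exists2 C : R, 0 < C &
  forall x y, I01 x -> I01 y -> x != y ->
    `|f x - f y| <= C / ln (expR 1 + 1 / `|x - y|).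

Definition modular p f : \bar R :=
  \int[@lebesgue_measure R]_(t in I01) ((`|f t| `^ p t)%:E).

Definition Lvar p : set (R -> R^o) :=
  [set f | measurable_fun I01 (f : R -> R) /\
    exists2 r : R, 0 < r & (modular p (r^-1 *: f) < +oo)%E].

(* The set is nonempty when [f] is in [Lvar p], so the real infimum is the
   intended one. *)
Definition luxemburg p f : R :=
  inf [set r : R | 0 < r /\ (modular p (r^-1 *: f) <= 1)%E].

Definition disjoint01 f g :=
  \forall t \ae leb01, Num.min `|f t| `|g t| = 0.

(* The set is nonempty for every x > 0, and also for x = 0 when [f] is
   essentially bounded. *)
Definition rearrangement f (x : R) : R :=
  inf [set s : R | 0 <= s /\
    (@lebesgue_measure R [set t | I01 t /\ (s < `|f t|)%R] <= x%:E)%E].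

End VariableLebesgue.

(* Main.v *)
Require Import Defs.
From HB Require Import structures.
From mathcomp Require Import all_boot all_order all_algebra.
From mathcomp Require Import all_classical all_reals all_analysis.
From mathcomp Require Import ess_sup_inf.
From mathcomp Require Import measurable_realfun ring lra.
Set Implicit Arguments.
Unset Strict Implicit.
Unset Printing Implicit Defensive.

Import Order.TTheory GRing.Theory Num.Theory.
Import numFieldNormedType.Exports.
Local Open Scope classical_set_scope.
Local Open Scope ring_scope.

(** Write [d = p - q], a nonnegative log-Hölder function on the unit interval.
    It is continuous, so by compactness either [d >= delta] everywhere for some
    [delta > 0], or [d] vanishes at some [x0].  All three conditions hold in the
    first case, and all three fail in the second; the equivalences follow.

    Gap.  The essential infimum and the rearrangement of [d] are at least
    [delta], which gives the first and the third condition.  For strict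
    singularity, split a function of norm at most 1 in the [p]-space at a high
    level [b]: above [b] its [q]-modular gains the factor [b `^ (- delta)], and
    below [b] it is controlled by the measure of the support
    ([gap_luxemburg_small]).  The supports of a disjoint sequence have measures
    that get arbitrarily small ([ae_disjoint_small]), so the inclusion is not
    bounded below along such a sequence.

    Zero.  The log-Hölder condition at [x0] says that [d t * ln h^-1 <= M]
    whenever [t] is within [2 * h] of [x0] ([log_holder_zero_decay]), in other
    words that [h^-1 `^ d t] is bounded by [expR M].  The set of such points
    contains a shell of measure exactly [h].  This at once excludes the first
    condition, and the third one, since [h `^ d^*(1 - h) >= expR (- M)].  For
    the second condition take the normalised indicators of the shells of radii
    [2 ^- (n + 2)].  A function that is constant on the shells and has
    [q]-modular at most 1 cannot exceed [h^-1] on a shell of measure [h] except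
    below level 1, so passing from exponent [q] to exponent [p] multiplies its
    modular by at most [expR M] ([shell_step_modular_le]).  Hence the two norms
    are equivalent on the span, and on its closure by the triangle inequality
    ([closed_span_luxemburg_le]). *)

(** * The modular and the Luxemburg functional *)
Section Modular.
Context {R : realType}.
Implicit Types p q f g : R -> R^o.

Lemma measurable_I01 : measurable (I01 : set (measurableTypeR R)).
Proof. exact: measurable_itv. Qed.

Lemma I01E (t : R) : I01 t <-> 0 <= t <= 1.
Proof. by rewrite /I01 /= in_itv. Qed.

Lemma lebesgue_I01 : @lebesgue_measure R I01 = 1%E.
Proof. by rewrite /I01 lebesgue_measure_itv /= lte_fin ltr01 oppr0 adde0. Qed.

Lemma modular_integrand_ge0 p f (t : R) : (0 <= (`|f t| `^ p t)%:E)%E.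
Proof. by rewrite lee_fin powR_ge0. Qed.
Hint Resolve modular_integrand_ge0 : core.

(** The exponent varies, so the integrand is rewritten as an exponential; the
    point 0 is split off because ln 0 is a junk value. *)
Lemma measurable_modular_integrand p f : exponent p ->
  measurable_fun I01 (f : R -> R) ->
  measurable_fun (I01 : set (measurableTypeR R))
    (fun t : R => (`|f t| `^ p t)%:E : \bar R).
Proof.
move=> [mp p1] mf; apply/measurable_EFinP.
have mabs : measurable_fun I01 (fun t : R => `|f t| : R).
  by apply: measurableT_comp.
apply: (@eq_measurable_fun _ _ _ _ _ (fun t : R => if `|f t| == 0 :> R
    then 0 else expR (p t * ln `|f t|))).
  move=> t; rewrite inE => It; rewrite /powR; case: ifPn => // _.
  by have /p1 := It; case: eqVneq => // ->; rewrite ler10.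
apply: measurable_fun_if => //.
- exact: measurable_I01.
- by apply: measurable_fun_eqr.
- apply: (measurable_funS measurable_I01); first exact: subIsetl.
  apply: measurableT_comp => //; apply: measurable_funM => //.
  by apply: measurableT_comp.
Qed.

Lemma modular_ge0 p f : (0 <= modular p f)%E.
Proof. by apply: integral_ge0 => t _. Qed.

Lemma modular_le p q f g : exponent p -> exponent q ->
  measurable_fun I01 (f : R -> R) -> measurable_fun I01 (g : R -> R) ->
  forall c : R, 0 <= c ->
  (forall t : R, I01 t -> `|f t| `^ p t <= c * `|g t| `^ q t) ->
  (modular p f <= c%:E * modular q g)%E.
Proof.
move=> exp_p exp_q mf mg c c0 fg.
rewrite /modular -ge0_integralZl_EFin//; first last.
- exact: measurable_modular_integrand.
- exact: measurable_I01.
apply: ge0_le_integral => //.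
- exact: measurable_I01.
- exact: measurable_modular_integrand.
- by apply: measurable_funeM; exact: measurable_modular_integrand.
Qed.

Lemma modular_mono p f g : exponent p ->
  measurable_fun I01 (f : R -> R) -> measurable_fun I01 (g : R -> R) ->
  (forall t : R, I01 t -> `|f t| <= `|g t|) -> (modular p f <= modular p g)%E.
Proof.
move=> exp_p mf mg fg; rewrite -[leRHS]mul1e; apply: modular_le => // t It.
by rewrite mul1r ge0_ler_powR ?nnegrE// ?fg// (le_trans ler01)//; apply: exp_p.2.
Qed.

Lemma measurable_fun_scale (c : R) f :
  measurable_fun I01 (f : R -> R) -> measurable_fun I01 (c *: f : R -> R).
Proof. by move=> mf; apply: measurable_funM. Qed.

(** Contracting by [c] gains at least the factor [c] because the exponent is
    at least 1.  This one inequality stands in for the homogeneity that the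
    modular lacks, and turns modular bounds into norm bounds. *)
Lemma modular_scale p f (c : R) : exponent p ->
  measurable_fun I01 (f : R -> R) -> 0 < c <= 1 ->
  (modular p (c *: f) <= c%:E * modular p f)%E.
Proof.
move=> exp_p mf c01; have /andP[c0 _] := c01; apply: modular_le => //.
- exact: measurable_fun_scale.
- exact: ltW.
- move=> t It; rewrite normrZ gtr0_norm//; apply: ge1r_powRZ => //.
  exact: exp_p.2.
Qed.

Lemma luxemburg_ge0 p f : 0 <= luxemburg p f.
Proof.
rewrite /luxemburg; set S := [set _ | _]; case: (pselect (S !=set0)) => S0.
  by apply: lb_le_inf => // r [/ltW].
by rewrite inf_out// => -[].
Qed.

Lemma luxemburg_le p f (r : R) : 0 < r ->
  (modular p (r^-1 *: f) <= 1)%E -> luxemburg p f <= r.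
Proof. by move=> r0 fr; apply: ge_inf => //; exists 0 => s [/ltW]. Qed.

Lemma Lvar_modular_le1 p f : exponent p -> Lvar p f ->
  exists2 r : R, 0 < r & (modular p (r^-1 *: f) <= 1)%E.
Proof.
move=> exp_p [mf [r r0 fr]].
have := modular_ge0 p (r^-1 *: f).
case E : (modular p (r^-1 *: f)) fr => [x| |]// _; rewrite lee_fin => x0.
(* The modular equals [x]; shrinking by [x + 1] brings it below 1. *)
pose c := (x + 1)^-1.
have c01 : 0 < c <= 1 by rewrite invr_gt0 ltr_wpDl//= invf_le1 ?ltr_wpDl// lerDr.
exists (r / c); first by rewrite divr_gt0//; case/andP: c01.
rewrite invf_div -[c / r]/(c * r^-1) -scalerA.
apply: (le_trans (modular_scale exp_p (measurable_fun_scale _ mf) c01)).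
by rewrite E -EFinM lee_fin /c ler_pdivrMl ?ltr_wpDl// mulr1 lerDl.
Qed.

Lemma luxemburg_lt p f (r : R) : exponent p -> Lvar p f ->
  luxemburg p f < r -> (modular p (r^-1 *: f) <= 1)%E.
Proof.
move=> exp_p Lf fr; have mf := Lf.1.
have hi : has_inf [set r : R | 0 < r /\ (modular p (r^-1 *: f) <= 1)%E].
  split; first by have [s s0 fs] := Lvar_modular_le1 exp_p Lf; exists s.
  by exists 0 => s [/ltW].
have rf : 0 < r - luxemburg p f by rewrite subr_gt0.
have [s [s0 fs]] := inf_adherent rf hi.
rewrite -/(luxemburg p f) subrKC => sr.
apply: (le_trans _ fs); apply: modular_mono => //; try exact: measurable_fun_scale.
move=> t _; rewrite !normrZ ler_wpM2r// !gtr0_norm ?invr_gt0// ?(lt_trans s0)//.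
by rewrite lef_pV2 ?posrE// ?(lt_trans s0)// ltW.
Qed.

(** How a bound between modulars becomes a bound between norms: for [r] just
    above the norm of [f] in the second space, dividing by [K * r] brings a
    modular at most [K] down to at most 1. *)
Lemma luxemburg_compare p q f (K : R) : exponent p -> exponent q ->
  Lvar q f -> 1 <= K ->
  (forall r : R, 0 < r -> (modular q (r^-1 *: f) <= 1)%E ->
     (modular p (r^-1 *: f) <= K%:E)%E) ->
  luxemburg p f <= K * luxemburg q f.
Proof.
move=> exp_p exp_q Lf K1 cmp; have K0 : 0 < K by exact: lt_le_trans K1.
have mf := Lf.1.
rewrite -ler_pdivrMl//; apply/ler_addgt0Pr => e e0.
rewrite ler_pdivrMl//; set r := _ + e.
have r0 : 0 < r by rewrite ltr_wpDl// luxemburg_ge0.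
apply: luxemburg_le; first by rewrite mulr_gt0.
rewrite invfM -scalerA.
have K01 : 0 < K^-1 <= 1 by rewrite invr_gt0 K0 invf_le1.
apply: (le_trans (modular_scale exp_p (measurable_fun_scale _ mf) K01)).
apply: (@le_trans _ _ (K^-1%:E * K%:E)%E).
  rewrite lee_pmul2l// ?lte_fin ?invr_gt0//.
  by apply: cmp => //; apply: luxemburg_lt => //; rewrite ltrDl.
by rewrite -EFinM mulVf// gt_eqF.
Qed.

End Modular.

(** * Seminorm properties and the inclusion for ordered exponents *)
Section LuxemburgSeminorm.
Context {R : realType}.
Implicit Types p q f g : R -> R^o.

Lemma powR_add_div_le (a b x y e : R) : 0 < a -> 0 < b -> 0 <= x -> 0 <= y ->
  1 <= e ->
  ((a + b)^-1 * (x + y)) `^ e <=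
  a / (a + b) * (a^-1 * x) `^ e + b / (a + b) * (b^-1 * y) `^ e.
Proof.
move=> a0 b0 x0 y0 e1; have ab0 : 0 < a + b by rewrite addr_gt0.
have t0 : 0 <= a / (a + b) by rewrite divr_ge0// ltW.
have t1 : a / (a + b) <= 1 by rewrite ler_pdivrMr// mul1r lerDl ltW.
have := convex_powR e1 (Itv01 t0 t1) (x := a^-1 * x) (y := b^-1 * y).
rewrite !inE /= !in_itv/= !andbT !mulr_ge0 ?invr_ge0 ?(ltW a0) ?(ltW b0)//.
move=> /(_ isT isT); rewrite convRE [X in X `^ _ <= _ -> _]convRE /= /unstable.onem.
have -> : 1 - a / (a + b) = b / (a + b) by field; rewrite gt_eqF.
by have -> : a / (a + b) * (a^-1 * x) + b / (a + b) * (b^-1 * y) =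
  (a + b)^-1 * (x + y) by field; rewrite !gt_eqF.
Qed.

Lemma measurable_fun_add f g : measurable_fun I01 (f : R -> R) ->
  measurable_fun I01 (g : R -> R) -> measurable_fun I01 (f + g : R -> R).
Proof. by move=> mf mg; apply: measurable_funD. Qed.

(** Convexity of the modular, with the weights [a / (a + b)] and
    [b / (a + b)] that make the two radii add up. *)
Lemma modular_add_le1 p f g (a b : R) : exponent p ->
  measurable_fun I01 (f : R -> R) -> measurable_fun I01 (g : R -> R) ->
  0 < a -> 0 < b ->
  (modular p (a^-1 *: f) <= 1)%E -> (modular p (b^-1 *: g) <= 1)%E ->
  (modular p ((a + b)^-1 *: (f + g)) <= 1)%E.
Proof.
move=> exp_p mf mg a0 b0 fa gb; have ab0 : 0 < a + b by rewrite addr_gt0.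
have mI := @measurable_I01 R.
have mfa := measurable_modular_integrand exp_p (measurable_fun_scale a^-1 mf).
have mgb := measurable_modular_integrand exp_p (measurable_fun_scale b^-1 mg).
have A0 : (0 <= a / (a + b)) by rewrite divr_ge0 ?ltW.
have B0 : 0 <= b / (a + b) by rewrite divr_ge0 ?ltW.
apply: (@le_trans _ _
  ((a / (a + b))%:E * modular p (a^-1 *: f) +
   (b / (a + b))%:E * modular p (b^-1 *: g))%E); last first.
  apply: (@le_trans _ _ ((a / (a + b))%:E * 1 + (b / (a + b))%:E * 1)%E).
    have AE : (0 <= (a / (a + b))%:E)%E by rewrite lee_fin; exact: A0.
    have BE : (0 <= (b / (a + b))%:E)%E by rewrite lee_fin; exact: B0.
    exact: (leeD (lee_wpmul2l AE fa) (lee_wpmul2l BE gb)).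
  by rewrite !mule1 -EFinD -mulrDl divff// gt_eqF.
have I0 (h : R -> R^o) (t : R) : I01 t -> (0 <= (`|h t| `^ p t)%:E)%E.
  by move=> _; rewrite lee_fin powR_ge0.
rewrite /modular -!ge0_integralZl_EFin//; try by [exact: I0|].
rewrite -ge0_integralD//; first last.
- exact: measurable_funeM.
- by move=> t _; rewrite -EFinM lee_fin mulr_ge0 ?powR_ge0// divr_ge0 ?ltW.
- exact: measurable_funeM.
- by move=> t _; rewrite -EFinM lee_fin mulr_ge0 ?powR_ge0// divr_ge0 ?ltW.
apply: ge0_le_integral => //.
- apply: measurable_modular_integrand => //; apply: measurable_fun_scale.
  exact: measurable_fun_add.
- by apply: emeasurable_funD; exact: measurable_funeM.
move=> t It; rewrite -!EFinM -EFinD lee_fin.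
have p1 : 1 <= p t by exact: exp_p.2.
rewrite !normrZ ![`|_^-1|]gtr0_norm ?invr_gt0//.
apply: (le_trans _ (powR_add_div_le a0 b0 (normr_ge0 _) (normr_ge0 _) p1)).
rewrite ge0_ler_powR ?nnegrE ?mulr_ge0 ?addr_ge0 ?invr_ge0 ?(ltW ab0)//.
  by rewrite (le_trans ler01).
by rewrite ler_wpM2l ?invr_ge0 ?(ltW ab0)// ler_normD.
Qed.

Lemma Lvar_add p f g : exponent p -> Lvar p f -> Lvar p g -> Lvar p (f + g).
Proof.
move=> exp_p Lf Lg; have [a a0 fa] := Lvar_modular_le1 exp_p Lf.
have [b b0 gb] := Lvar_modular_le1 exp_p Lg.
split; first exact: measurable_fun_add Lf.1 Lg.1.
exists (a + b); first by rewrite addr_gt0.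
by apply: le_lt_trans (modular_add_le1 exp_p Lf.1 Lg.1 a0 b0 fa gb) _; exact: ltry.
Qed.

Lemma luxemburg_triangle p f g : exponent p -> Lvar p f -> Lvar p g ->
  luxemburg p (f + g) <= luxemburg p f + luxemburg p g.
Proof.
move=> exp_p Lf Lg; apply/ler_addgt0Pr => e e0.
have e20 : 0 < e / 2 by rewrite divr_gt0.
rewrite (_ : _ + e = (luxemburg p f + e / 2) + (luxemburg p g + e / 2)); last first.
  by rewrite addrACA -splitr.
have rf : 0 < luxemburg p f + e / 2 by rewrite ltr_wpDl// luxemburg_ge0.
have rg : 0 < luxemburg p g + e / 2 by rewrite ltr_wpDl// luxemburg_ge0.
apply: (luxemburg_le (addr_gt0 rf rg)).
have fr : (modular p ((luxemburg p f + e / 2)^-1 *: f) <= 1)%E.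
  by apply: (luxemburg_lt exp_p Lf); rewrite ltrDl; exact: e20.
have gr : (modular p ((luxemburg p g + e / 2)^-1 *: g) <= 1)%E.
  by apply: (luxemburg_lt exp_p Lg); rewrite ltrDl; exact: e20.
exact: (modular_add_le1 exp_p Lf.1 Lg.1 rf rg fr gr).
Qed.

Lemma modularZN p f (c : R) : modular p (c *: (- f)) = modular p (c *: f).
Proof.
by rewrite (scalerN c f); apply: eq_integral => t _; rewrite /= normrN.
Qed.

Lemma luxemburgN p f : luxemburg p (- f) = luxemburg p f.
Proof.
apply: (congr1 inf); apply/funext => r.
by rewrite /mkset (modularZN p f r^-1).
Qed.

Lemma LvarN p f : Lvar p f -> Lvar p (- f).
Proof.
move=> [mf [r r0 fr]]; split; first exact: measurable_funN.
exists r; first exact: r0.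
by rewrite (modularZN p f r^-1); exact: fr.
Qed.

Lemma scale_cancel f (c r : R) : 0 < c -> (c * r)^-1 *: (c *: f) = r^-1 *: f.
Proof.
move=> c0; rewrite (scalerA _ _ f); congr (_ *: f).
by rewrite invfM mulrAC mulVf ?mul1r// gt_eqF.
Qed.

Lemma Lvar_scale p f (c : R) : 0 < c -> Lvar p f -> Lvar p (c *: f).
Proof.
move=> c0 [mf [r r0 fr]]; split; first exact: measurable_fun_scale.
exists (c * r); first by rewrite mulr_gt0.
by rewrite (scale_cancel f r c0).
Qed.

Lemma luxemburgZ p f (c : R) : exponent p -> Lvar p f -> 0 < c ->
  luxemburg p (c *: f) = c * luxemburg p f.
Proof.
move=> exp_p Lf c0.
have le_cf g d : Lvar p g -> 0 < d -> luxemburg p (d *: g) <= d * luxemburg p g.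
  move=> Lg d0; rewrite -ler_pdivrMl//; apply/ler_addgt0Pr => e e0.
  rewrite ler_pdivrMl//; apply: luxemburg_le.
    by rewrite mulr_gt0// ltr_wpDl// luxemburg_ge0.
  rewrite (scale_cancel g _ d0).
  by apply: luxemburg_lt => //; rewrite ltrDl.
have ci : 0 < c^-1 by rewrite invr_gt0.
have fE : c^-1 *: (c *: f) = f.
  by rewrite (scalerA _ _ f) mulVf ?(scale1r f)// gt_eqF.
have := le_cf _ _ (Lvar_scale c0 Lf) ci; rewrite fE -ler_pdivrMl// invrK => h.
by apply/eqP; rewrite eq_le h andbT; exact: le_cf.
Qed.

Lemma powR_le_add1 (x a b : R) : 0 <= x -> 1 <= a -> a <= b ->
  x `^ a <= 1 + x `^ b.
Proof.
move=> x0 a1 ab; have [x1|x1] := leP 1 x.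
  by rewrite (le_trans (ler_powR x1 ab))// lerDr.
have a0 : 0 <= a by exact: le_trans a1.
apply: (@le_trans _ _ 1); last by rewrite lerDl powR_ge0.
have -> : 1 = 1 `^ a by rewrite powR1.
by apply: ge0_ler_powR; rewrite ?nnegrE// ltW.
Qed.

Section inclusion.
Variables (p q : R -> R^o) (exp_p : exponent p) (exp_q : exponent q).
Hypothesis le_qp : forall t : R, I01 t -> q t <= p t.

(** The constant 1 accounts for the points where [|f|] is at most 1, on which
    lowering the exponent raises the power; the interval has measure 1. *)
Lemma modular_le_add1 f : measurable_fun I01 (f : R -> R) ->
  (modular q f <= 1 + modular p f)%E.
Proof.
move=> mf; have mI := @measurable_I01 R.
have mp := measurable_modular_integrand exp_p mf.
have -> : 1%E = (\int[@lebesgue_measure R]_(t in I01) (cst 1%E t))%E.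
  by rewrite integral_cst// mul1e; exact/esym/lebesgue_I01.
rewrite -ge0_integralD//; apply: ge0_le_integral => //.
- exact: measurable_modular_integrand.
- exact: emeasurable_funD.
- move=> t It; rewrite -EFinD lee_fin; apply: powR_le_add1 => //.
    exact: exp_q.2.
  exact: le_qp.
Qed.

Lemma Lvar_mono f : Lvar p f -> Lvar q f.
Proof.
move=> [mf [r r0 fr]]; split=> //; exists r; first exact: r0.
apply: le_lt_trans (modular_le_add1 (measurable_fun_scale _ mf)) _.
by rewrite lte_add_pinfty// ltry.
Qed.

Lemma luxemburg_le2 f : Lvar p f -> luxemburg q f <= 2 * luxemburg p f.
Proof.
move=> Lf; have K1 : 1 <= 2 :> R by lra.
apply: (luxemburg_compare exp_q exp_p Lf K1) => r r0 fr.
apply: (le_trans (modular_le_add1 (measurable_fun_scale _ Lf.1))).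
by rewrite (_ : 2 = 1 + 1)// EFinD leeD2l.
Qed.

End inclusion.
End LuxemburgSeminorm.

(** * A log-Hölder function near one of its zeros *)
Section NearZero.
Context {R : realType}.
Implicit Types f g d : R -> R^o.

Lemma log_holderB f g : log_holder f -> log_holder g -> log_holder (f \- g).
Proof.
move=> [C C0 fC] [D D0 gD]; exists (C + D); first exact: addr_gt0.
move=> x y Ix Iy xy; rewrite mulrDl.
have E (a b c e : R) : a - b - (c - e) = (a - c) - (b - e) by ring.
rewrite (E (f x) (g x) (f y) (g y)).
apply: (le_trans (ler_normB _ _)); apply: lerD; [exact: fC|exact: gD].
Qed.

Lemma expR1_ge2 : 2 <= expR 1 :> R.
Proof. by have := expR_ge1Dx (1 : R); rewrite -natr1 addrC. Qed.

(** The log-Hölder modulus of continuity at a zero, in the form in which it is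
    used: it bounds [h^-1 `^ |d t|] by [expR M] at every point within distance
    [2 * h] of the zero.  The factor 2 is absorbed by
    [ln h^-1 <= 1 + ln (expR 1 + 1 / `|t - x0|)]. *)
Lemma log_holder_zero_decay d (x0 : R) : log_holder d -> I01 x0 -> d x0 = 0 ->
  exists2 M : R, 0 < M & forall h t : R, 0 < h < 1 -> I01 t ->
    `|t - x0| <= 2 * h -> `|d t| <= M / ln h^-1.
Proof.
move=> [C C0 dC] Ix0 dx0; exists (2 * C); first by rewrite mulr_gt0.
move=> h t /andP[h0 h1] It th.
have lnh : 0 < ln h^-1 by rewrite ln_gt0// invf_gt1.
have [->|tx] := eqVneq t x0.
  by rewrite dx0 normr0 divr_ge0 ?mulr_ge0 ?ltW.
have := dC _ _ It Ix0 tx; rewrite dx0 subr0 => /le_trans; apply.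
set L := ln _.
have tx0 : 0 < `|t - x0| by rewrite normr_gt0 subr_eq0.
have e2 := expR1_ge2.
have arg0 : 0 < expR 1 + 1 / `|t - x0| by rewrite addr_gt0 ?expR_gt0 ?divr_gt0.
have L1 : 1 <= L.
  rewrite -[leLHS](expRK 1) /L ler_ln ?posrE ?expR_gt0//.
  by rewrite lerDl divr_ge0.
have hL : ln h^-1 <= 2 * L.
  have -> : 2 * L = L + L by rewrite mulr_natl.
  apply: (@le_trans _ _ (1 + L)); last by rewrite lerD2r.
  rewrite -[X in X + _](expRK 1) /L -lnM ?posrE ?expR_gt0//.
  rewrite ler_ln ?posrE ?invr_gt0 ?mulr_gt0 ?expR_gt0//.
  apply: (@le_trans _ _ (2 * (1 / `|t - x0|))).
    by rewrite mulrA mulr1 ler_pdivlMr// ler_pdivrMl// mulrC.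
  apply: ler_pM => //.
  by rewrite lerDr expR_ge0.
rewrite ler_pdivrMr ?(lt_le_trans ltr01)// mulrAC ler_pdivlMr//.
by rewrite -mulrA mulrCA ler_pM2l.
Qed.

(** One side of the annulus of radii [h] and [2 * h] around [x0], the side
    being the one with room inside the unit interval. *)
Definition shell (x0 h : R) : set R :=
  if x0 <= 2^-1 then `]x0 + h, x0 + 2 * h]%classic
  else `[x0 - 2 * h, x0 - h[%classic.

Lemma measurable_shell x0 h : measurable (shell x0 h : set (measurableTypeR R)).
Proof. by rewrite /shell; case: ifP => _; exact: measurable_itv. Qed.

Lemma lebesgue_shell x0 h : 0 < h -> @lebesgue_measure R (shell x0 h) = h%:E.
Proof.
move=> h0; rewrite /shell; case: ifP => _; rewrite lebesgue_measure_itv/= lte_fin.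
  by rewrite ifT -?EFinD; [congr EFin; ring|lra].
by rewrite ifT -?EFinD; [congr EFin; ring|lra].
Qed.

Lemma shell_dist x0 h t : 0 < h -> shell x0 h t -> h < `|t - x0| <= 2 * h.
Proof.
move=> h0; rewrite /shell; case: ifP => _ /=; rewrite in_itv/= => /andP[a b].
  by rewrite ger0_norm ?subr_ge0; [apply/andP; split; lra|lra].
by rewrite ler0_norm ?subr_le0; [apply/andP; split; lra|lra].
Qed.

Lemma shell_I01 x0 h : I01 x0 -> 0 < h <= 4^-1 -> shell x0 h `<=` I01.
Proof.
move=> /I01E /andP[x00 x01] /andP[h0 h4] t; have h4' : 4 * h <= 1.
  by rewrite -ler_pdivlMl// mulr1.
rewrite /shell; case: ifPn => [xh|]; last rewrite -ltNge => xh.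
  have xh2 : 2 * x0 <= 1 by rewrite -ler_pdivlMl// mulr1.
  rewrite /= in_itv /= => /andP[a b]; apply/I01E/andP; split; lra.
have xh2 : 1 < 2 * x0 by rewrite -ltr_pdivrMl// mulr1.
rewrite /= in_itv /= => /andP[a b]; apply/I01E/andP; split; lra.
Qed.

(** The exponent is shifted by 2 so that already the largest shell has outer
    radius at most 1/2 and thus stays in the unit interval; halving the radius
    makes consecutive shells disjoint. *)
Definition radius (n : nat) : R := 2^-1 ^+ n.+2.

Lemma radius_gt0 n : 0 < radius n.
Proof. by rewrite exprn_gt0// invr_gt0. Qed.

Lemma radius_le4 n : radius n <= 4^-1.
Proof.
rewrite /radius exprS exprS mulrA; have -> : 4^-1 = 2^-1 * 2^-1 :> R by field.
by rewrite ger_pMr ?mulr_gt0 ?invr_gt0// exprn_ile1// ?invr_ge0// invf_le1// ler1n.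
Qed.

Lemma radius_lt m n : (m < n)%N -> 2 * radius n <= radius m.
Proof.
move=> mn; rewrite /radius exprS mulrA divff// mul1r ler_wiXn2l//.
by rewrite invf_le1// ler1n.
Qed.

Lemma shell_disjoint x0 m n t :
  shell x0 (radius m) t -> shell x0 (radius n) t -> m = n.
Proof.
move=> /(shell_dist (radius_gt0 m))/andP[m1 m2].
move=> /(shell_dist (radius_gt0 n))/andP[n1 n2].
have [/radius_lt h|/radius_lt h|//] := ltngtP m n.
- by have := lt_le_trans m1 (le_trans n2 h); rewrite ltxx.
- by have := lt_le_trans n1 (le_trans m2 h); rewrite ltxx.
Qed.

End NearZero.

(** * Spans in the variable Lebesgue space *)
Section NotSingular.
Context {R : realType}.
Implicit Types p q f g v w : R -> R^o.

(** Since exponents are at least 1, a value [y >= 1] satisfies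
    [y <= y `^ p t]: a Chebyshev inequality that does not see the exponent. *)
Lemma modular_ge p f (A : set R) (y : R) : exponent p ->
  measurable_fun I01 (f : R -> R) ->
  measurable (A : set (measurableTypeR R)) -> A `<=` I01 -> 1 <= y ->
  (forall t, A t -> y <= `|f t|) ->
  (y%:E * @lebesgue_measure R A <= modular p f)%E.
Proof.
move=> exp_p mf mA AI y1 yf; have mI := @measurable_I01 R.
have mg := measurable_modular_integrand exp_p mf.
have g0 (t : R) : I01 t -> (0 <= (`|f t| `^ p t)%:E)%E.
  by move=> _; rewrite lee_fin powR_ge0.
have -> : (y%:E * @lebesgue_measure R A =
    \int[@lebesgue_measure R]_(t in A) (cst y%:E t))%E.
  by rewrite integral_cst.
apply: (@le_trans _ _ (\int[@lebesgue_measure R]_(t in A) (`|f t| `^ p t)%:E)%E);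
  last by apply: ge0_subset_integral.
apply: ge0_le_integral => //.
- by move=> t _; rewrite lee_fin (le_trans ler01).
- exact: measurable_funS mg.
- move=> t At; rewrite lee_fin (le_trans (yf t At))// le1r_powR//.
    exact: le_trans (yf t At).
  exact/exp_p.2/AI.
Qed.

Lemma Lvar_bounded p f (B : R) : exponent p ->
  measurable_fun I01 (f : R -> R) -> 0 < B ->
  (forall t : R, I01 t -> `|f t| <= B) -> Lvar p f.
Proof.
move=> exp_p mf B0 fB; split=> //; exists B; first exact: B0.
have mI := @measurable_I01 R.
apply: (@le_lt_trans _ _ (\int[@lebesgue_measure R]_(t in I01) (cst 1%E t))%E).
  apply: ge0_le_integral => //.
  - exact: (measurable_modular_integrand exp_p (measurable_fun_scale B^-1 mf)).
  - move=> t It; rewrite lee_fin /= -[leRHS](_ : 1 `^ p t = 1);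
      last by rewrite powR1.
    have p0 : 0 <= p t by rewrite (le_trans ler01)//; exact: exp_p.2.
    rewrite ge0_ler_powR ?nnegrE// normrZ gtr0_norm ?invr_gt0//.
    by rewrite ler_pdivrMl// mulr1; exact: fB.
by rewrite integral_cst// mul1e (le_lt_trans _ (ltry 1))// [leLHS]lebesgue_I01.
Qed.

Lemma Lvar0 p : exponent p -> Lvar p 0.
Proof.
move=> exp_p; apply: (@Lvar_bounded _ _ 1) => //; first exact: measurable_cst.
by move=> t _; rewrite normr0.
Qed.

Lemma Lvar_linear_span p (f : nat -> R -> R^o) w : exponent p ->
  (forall n, Lvar p (f n)) -> linear_span f w -> Lvar p w.
Proof.
move=> exp_p Lf [n [a ->]]; elim/big_ind: _ => [||i _]; first exact: Lvar0.
  by move=> u v Lu Lv; exact: Lvar_add.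
have [a0|a0|->] := ltgtP (a i) 0.
- rewrite -[a i]opprK (scaleNr _ (f i)); apply: LvarN.
  by apply: Lvar_scale; rewrite ?oppr_gt0.
- exact: Lvar_scale.
- by rewrite (scale0r (f i)); exact: Lvar0.
Qed.

Lemma le_of_approximation (e a b c d z k : R) : a <= b + c -> c <= k * d ->
  k * d <= k * (z + 2 * b) -> b * (1 + 2 * k) <= e -> a <= k * z + e.
Proof. by move=> h1 h2 h3 h4; nra. Qed.

(** Norm comparisons pass from a span to its closure: if [w] approximates [v]
    in the stronger norm, then it does so up to a factor 2 in the weaker one,
    and the triangle inequality applies in both spaces. *)
Lemma closed_span_luxemburg_le p q (f : nat -> R -> R^o) (K : R) :
  exponent p -> exponent q -> (forall t : R, I01 t -> q t <= p t) -> 0 <= K ->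
  (forall n, Lvar p (f n)) ->
  (forall w, linear_span f w -> luxemburg p w <= K * luxemburg q w) ->
  forall v, closed_linear_span (Lvar p) (luxemburg p) f v ->
    luxemburg p v <= K * luxemburg q v.
Proof.
move=> exp_p exp_q qp K0 Lf Kw v [Lv vw]; apply/ler_addgt0Pr => e e0.
have K1 : 0 < 1 + 2 * K by rewrite ltr_wpDr// mulr_ge0.
have [w sw vwe] := vw _ (divr_gt0 e0 K1).
have Lw := Lvar_linear_span exp_p Lf sw.
have LwN : Lvar p (- w) by exact: LvarN.
have Lvw : Lvar p (v - w) by exact: Lvar_add.
have LvwN : Lvar p (- (v - w)) by exact: LvarN.
have le1 : luxemburg p v <= luxemburg p (v - w) + luxemburg p w.
  have := luxemburg_triangle exp_p Lvw Lw; rewrite (subrK w v); exact.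
have le2 : luxemburg q w <= luxemburg q v + 2 * luxemburg p (v - w).
  have -> : w = v + - (v - w) by rewrite opprB addrC subrK.
  rewrite [X in 2 * luxemburg p X](_ : _ = v - w);
    last by rewrite opprD opprK addrA subrr add0r.
  apply: (le_trans (luxemburg_triangle exp_q (Lvar_mono exp_p exp_q qp Lv)
    (Lvar_mono exp_p exp_q qp LvwN))).
  rewrite lerD2l luxemburgN; exact: luxemburg_le2.
have le3 := Kw _ sw.
have le4 := ler_wpM2l K0 le2.
have le5 : luxemburg p (v - w) * (1 + 2 * K) <= e.
  by rewrite -ler_pdivlMr// ltW.
exact: (le_of_approximation le1 le3 le4 le5).
Qed.

End NotSingular.

(** * A span with equivalent norms when the exponents meet *)
Section ShellSpan.
Context {R : realType}.
Implicit Types f g v w : R -> R^o.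
Variables (p q : R -> R^o) (x0 M : R).
Hypotheses (exp_p : exponent p) (exp_q : exponent q).
Hypothesis le_qp : forall t : R, I01 t -> q t <= p t.
Hypotheses (Ix0 : I01 x0) (M0 : 0 < M).
Hypothesis decay : forall h t : R, 0 < h < 1 -> I01 t -> `|t - x0| <= 2 * h ->
  `|p t - q t| <= M / ln h^-1.

Local Notation A n := (shell x0 (radius n)).

(** The form of the elements of the span of the shell indicators.  It is stated
    without coefficients so that it is visibly preserved by scaling, which is
    all that is needed to normalise a function by its norm. *)
Definition shell_step v := (forall n t u, A n t -> A n u -> v t = v u) /\
  (forall t, (forall n, ~ A n t) -> v t = 0).

Lemma radius_shell_I01 n : A n `<=` I01.
Proof. by apply: shell_I01 => //; rewrite radius_gt0 radius_le4. Qed.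

Lemma radius_lt1 n : 0 < (radius n : R) < 1.
Proof.
by rewrite radius_gt0/= (le_lt_trans (radius_le4 n))// invf_lt1// ltr1n.
Qed.

Lemma shell_gap n t : A n t -> (radius n)^-1 `^ (p t - q t) <= expR M.
Proof.
move=> At; have h01 := @radius_lt1 n; have /andP[h0 h1] := h01.
have lnh : 0 < ln (radius n : R)^-1 by rewrite ln_gt0// invf_gt1.
have /andP[_ tx] := shell_dist h0 At.
have := decay h01 (radius_shell_I01 At) tx.
rewrite /powR gt_eqF ?invr_gt0// ler_expR => dt.
rewrite -ler_pdivlMr//; exact: le_trans (ler_norm _) dt.
Qed.

(** The heart of the negative case.  A function with [q]-modular at most 1 that
    is constant on a shell of measure [h] has there a value [y] at most [h^-1]
    if it exceeds 1, because [q >= 1].  Hence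
    [y `^ p t = y `^ q t * y `^ (p t - q t)] is at most [expR M * y `^ q t] by
    the decay of [p - q] at its zero; for [y <= 1] the power decreases in the
    exponent and nothing is lost. *)
Lemma shell_step_modular_le v : measurable_fun I01 (v : R -> R) ->
  shell_step v -> (modular q v <= 1)%E -> (modular p v <= (expR M)%:E)%E.
Proof.
move=> mv [vA v0] qv.
have eM : 0 <= expR M by exact: expR_ge0.
have eM1 : 1 <= expR M by rewrite -[leLHS]expR0 ler_expR ltW.
suff : (modular p v <= (expR M)%:E * modular q v)%E.
  move=> /le_trans; apply; rewrite -[leRHS]mule1.
  by apply: lee_wpmul2l => //; rewrite lee_fin.
apply: modular_le => // t It.
have p1 : 1 <= p t by exact: exp_p.2.
have q1 : 1 <= q t by exact: exp_q.2.
have qp := le_qp It.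
have [t0|t0] := eqVneq `|v t| (0 : R).
  by rewrite t0 !powR0 ?mulr0// gt_eqF// (lt_le_trans ltr01).
have vt0 : 0 < `|v t| by rewrite lt_def t0 normr_ge0.
have [v1|v1] := leP `|v t| 1.
  rewrite (@le_trans _ _ (`|v t| `^ q t))//; first by rewrite ger_powR ?vt0.
  by rewrite ler_peMl ?powR_ge0.
have [n At] : exists n, A n t.
  apply: contrapT => /forallNP nA; move: t0; rewrite v0//.
  by rewrite normr0 eqxx.
have h0 := @radius_gt0 R n.
have yh : `|v t| <= (radius n)^-1.
  rewrite -[leRHS]mulr1 ler_pdivlMl// mulrC -lee_fin EFinM.
  rewrite -(lebesgue_shell x0 h0).
  apply: (le_trans _ qv); apply: modular_ge => //.
  - exact: measurable_shell.
  - exact: radius_shell_I01.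
  - exact: ltW.
  - by move=> u Au; rewrite (vA n u t).
have -> : p t = q t + (p t - q t) by rewrite addrC subrK.
rewrite powRD; last by rewrite t0 implybT.
rewrite mulrC ler_wpM2r ?powR_ge0//.
apply: le_trans (shell_gap At).
by apply: ge0_ler_powR; rewrite ?nnegrE ?subr_ge0// invr_ge0 ltW.
Qed.

Definition shell_indic n : R -> R^o := \1_(A n).

Definition shell_unit n : R -> R^o :=
  (luxemburg p (shell_indic n))^-1 *: shell_indic n.

Lemma shell_indicE n t : A n t -> shell_indic n t = 1.
Proof. by move=> At; rewrite /shell_indic indicE mem_set. Qed.

Lemma shell_indic0 n t : ~ A n t -> shell_indic n t = 0.
Proof. by move=> At; rewrite /shell_indic indicE memNset. Qed.

Lemma Lvar_shell_indic n : Lvar p (shell_indic n).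
Proof.
apply: (@Lvar_bounded _ _ _ 1) => //.
  by apply: measurable_indic; exact: measurable_shell.
move=> t _; have [At|At] := pselect (A n t).
  by rewrite shell_indicE// normr1.
by rewrite shell_indic0// normr0.
Qed.

(** If the norm vanished, dividing by half the measure of the shell would still
    leave a modular at most 1, but the modular is then at least 2. *)
Lemma luxemburg_shell_indic_gt0 n : 0 < luxemburg p (shell_indic n).
Proof.
have /andP[h0 h1] := @radius_lt1 n.
rewrite lt_def luxemburg_ge0 andbT; apply/negP => /eqP N0.
have h20 : 0 < radius n / 2 :> R by rewrite divr_gt0.
have /(luxemburg_lt exp_p (Lvar_shell_indic n)) :
    luxemburg p (shell_indic n) < radius n / 2.
  by rewrite N0.
apply/negP; rewrite -ltNge.
apply: (@lt_le_trans _ _ (((radius n / 2)^-1)%:E * @lebesgue_measure R (A n))%E).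
  rewrite lebesgue_shell// -EFinM lte_fin invf_div mulfVK ?gt_eqF// ltr1n//.
apply: modular_ge => //.
- exact: (measurable_fun_scale _ (Lvar_shell_indic n).1).
- exact: measurable_shell.
- exact: radius_shell_I01.
- rewrite invf_ge1// ler_pdivrMr//; lra.
- by move=> t At; rewrite normrZ shell_indicE// normr1 mulr1 ler_norm.
Qed.

Lemma Lvar_shell_unit n : Lvar p (shell_unit n).
Proof.
apply: Lvar_scale; last exact: Lvar_shell_indic.
by rewrite invr_gt0; exact: luxemburg_shell_indic_gt0.
Qed.

Lemma luxemburg_shell_unit n : luxemburg p (shell_unit n) = 1.
Proof.
have N0 := luxemburg_shell_indic_gt0 n.
have Ni : 0 < (luxemburg p (shell_indic n))^-1 by rewrite invr_gt0.
rewrite /shell_unit (luxemburgZ exp_p (Lvar_shell_indic n) Ni) mulVf//.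
by rewrite gt_eqF.
Qed.

Lemma disjoint_shell_unit m n : m <> n ->
  disjoint01 (shell_unit m) (shell_unit n).
Proof.
move=> mn; apply: nearW => t; have E k : ~ A k t -> shell_unit k t = 0.
  by move=> Ak; rewrite /shell_unit /= -[LHS]/(_ * shell_indic k t)
    shell_indic0// mulr0.
have [Am|Am] := pselect (A m t).
  have An : ~ A n t by move=> An; exact/mn/(shell_disjoint Am An).
  by rewrite (E n)// normr0 min_r.
by rewrite (E m)// normr0 min_l.
Qed.

Lemma shell_stepZ (c : R) v : shell_step v -> shell_step (c *: v).
Proof.
move=> [vA v0]; split=> [n t u At Au|t nA].
  by rewrite -[LHS]/(c * v t) (vA n t u).
by rewrite -[LHS]/(c * v t) v0 ?mulr0.
Qed.

Lemma shell_step_indic n : shell_step (shell_indic n).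
Proof.
split=> [m t u At Au|t nA]; last exact: shell_indic0.
have [Ant|Ant] := pselect (A n t).
  have mn : m = n by exact: shell_disjoint At Ant.
  by rewrite !shell_indicE// -mn.
rewrite !shell_indic0// => Anu; have mn : m = n by exact: shell_disjoint Au Anu.
by apply: Ant; rewrite -mn.
Qed.

Lemma shell_step_span w : linear_span shell_unit w -> shell_step w.
Proof.
move=> [n [a ->]]; elim/big_ind: _ => [|u v [uA u0] [vA v0]|i _].
- by split.
- split=> [k t s At As|t nA].
    by rewrite -[LHS]/(u t + v t) (uA k t s)// (vA k t s).
  by rewrite -[LHS]/(u t + v t) u0// v0// addr0.
- exact/shell_stepZ/shell_stepZ/shell_step_indic.
Qed.

Lemma shell_span_luxemburg_le w : linear_span shell_unit w ->
  luxemburg p w <= expR M * luxemburg q w.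
Proof.
move=> sw; have Lw := Lvar_linear_span exp_p Lvar_shell_unit sw.
have eM1 : 1 <= expR M by rewrite -[leLHS]expR0 ler_expR ltW.
apply: (luxemburg_compare exp_p exp_q (Lvar_mono exp_p exp_q le_qp Lw) eM1) => r r0.
apply: shell_step_modular_le; first exact: (measurable_fun_scale _ Lw.1).
exact/shell_stepZ/shell_step_span.
Qed.

Lemma shell_not_singular : ~ disjointly_strictly_singular (Lvar p) (luxemburg p)
  disjoint01 (Lvar q) (luxemburg q)
  (idfun : {linear (R -> R^o) -> (R -> R^o)}).
Proof.
move=> [_]; apply; exists shell_unit; split.
- by move=> n; split; [exact: Lvar_shell_unit|exact: luxemburg_shell_unit].
- exact: disjoint_shell_unit.
exists (expR M)^-1, 2; split; rewrite ?invr_gt0 ?expR_gt0// => v sv.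
apply/andP; split; last exact: (luxemburg_le2 exp_p exp_q le_qp sv.1).
rewrite ler_pdivrMl ?expR_gt0//.
exact: (closed_span_luxemburg_le exp_p exp_q le_qp (expR_ge0 M) Lvar_shell_unit
  shell_span_luxemburg_le sv).
Qed.

End ShellSpan.

(** * Small supports when the exponents have a gap *)
Section Singular.
Context {R : realType}.
Implicit Types f g : R -> R^o.
Local Notation mu := (@lebesgue_measure R).

(** Almost disjoint subsets of a set of measure 1 cannot all exceed the same
    positive measure.  Replacing the sets by the disjoint ones obtained by
    removing the earlier ones changes them only by null sets. *)
Lemma ae_disjoint_small (B : nat -> set (measurableTypeR R)) (eta : R) :
  (forall n, measurable (B n)) -> (forall n, B n `<=` I01) ->
  (forall m n, m <> n -> mu (B m `&` B n) = 0%E) -> 0 < eta ->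
  exists n, (mu (B n) <= eta%:E)%E.
Proof.
move=> mB BI Bd eta0; apply: contrapT => /forallNP big.
have mD n : measurable (seqDU B n).
  by apply: measurableD => //; exact: bigsetU_measurable.
have muD n : mu (seqDU B n) = mu (B n).
  rewrite /seqDU; set U := \big[_/_]_(_ < _) _.
  have mU : measurable U by exact: bigsetU_measurable.
  have BU0 : mu (B n `&` U) = 0%E.
    apply/eqP; rewrite eq_le measure_ge0 andbT.
    rewrite /U big_distrr/=.
    apply: (le_trans (Boole_inequality mu (A := fun i => B n `&` B i) _)).
      by move=> i _; exact: measurableI.
    by rewrite big1// => i _; apply: Bd => /eqP; rewrite gtn_eqF.
  by rewrite [RHS](measureDI mu (mB n) mU) [X in (_ + X)%E]BU0 adde0.
pose N := Num.Def.archi_bound eta^-1.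
have Neta : 1 < N%:R * eta.
  rewrite -ltr_pdivrMr// mul1r.
  by apply: archi_boundP; rewrite invr_ge0 ltW.
suff : (mu I01 < mu (\big[setU/set0]_(k < N) seqDU B k))%E.
  apply/negP; rewrite -leNgt; apply: le_measure; rewrite ?inE.
  - exact: bigsetU_measurable.
  - exact: measurable_I01.
  - elim/big_ind: _ => // [U V UI VI t [/UI|/VI]//|k _ t [Bt _]].
    exact: BI Bt.
rewrite [ltLHS]lebesgue_I01 (measure_bigsetU mu mD (@trivIset_seqDU _ B)).
apply: (@lt_le_trans _ _ (\sum_(k < N) eta%:E)%E).
  by rewrite sumEFin lte_fin sumr_const card_ord -mulr_natl.
apply: lee_sum => k _; rewrite [leRHS]muD ltW//.
by have /negP := big k; rewrite -ltNge.
Qed.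

Lemma measurable_support f : measurable_fun I01 (f : R -> R) ->
  measurable ([set t | I01 t /\ f t != 0] : set (measurableTypeR R)).
Proof.
move=> mf; rewrite (_ : [set _ | _] = I01 `&` f @^-1` (~` [set 0])).
  by apply: mf; [exact: measurable_I01|exact: measurableC].
by apply/seteqP; split=> t [It] /= => [/eqP|/eqP]; split.
Qed.

(** With a gap between the exponents, the unit ball of the smaller space is
    uniformly absolutely continuous in the larger one.  Where [|g| <= b] the
    [q]-modular is controlled by the measure of the support; where [|g| > b]
    the gap gives [|g| `^ q t <= b `^ (- delta) * |g| `^ p t], which is small
    for large [b].  The number [c] magnifies [g = f / 2], and the two
    contributions are made at most 1/2 each. *)
Lemma gap_luxemburg_small (p q : R -> R^o) (delta P c : R) :
  exponent p -> exponent q -> 0 < delta ->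
  (forall t : R, I01 t -> q t + delta <= p t) ->
  (forall t : R, I01 t -> p t <= P) -> 1 <= c ->
  exists2 eta : R, 0 < eta & forall f, Lvar p f -> luxemburg p f <= 1 ->
    (mu [set t | I01 t /\ (f t != 0)%R] <= eta%:E)%E -> luxemburg q f <= 2 / c.
Proof.
move=> exp_p exp_q d0 gap pP c1.
have c0 : 0 < c by exact: lt_le_trans c1.
pose a := c `^ P; have a0 : 0 < a by exact: powR_gt0.
have P1 : 1 <= P.
  by apply: (@le_trans _ _ (p 0)); [apply: exp_p.2|apply: pP]; apply/I01E; lra.
have a1 : 1 <= a by rewrite (le_trans c1)// le1r_powR.
(* Chosen so that [a * b `^ (- delta) = 2^-1]. *)
pose b := (2 * a) `^ delta^-1.
have b1 : 1 <= b.
  rewrite /b -[leLHS](powRr0 (2 * a)) ler_powR ?invr_ge0 ?(ltW d0)//; lra.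
have b0 : 0 < b by exact: lt_le_trans b1.
have bd : a * b `^ (- delta) = 2^-1.
  rewrite powRN -powRrM mulVf ?gt_eqF// powRr1 ?mulr_ge0 ?ltW//.
  by rewrite invfM mulrCA mulfV ?mulr1// gt_eqF.
have abP : 0 < a * b `^ P by rewrite mulr_gt0// powR_gt0.
exists (2^-1 / (a * b `^ P)); first by rewrite divr_gt0.
move=> f Lf f1; set A := [set t | _] => Aeta.
have mI := @measurable_I01 R.
have mA : measurable (A : set (measurableTypeR R)).
  exact: measurable_support Lf.1.
have f2 : (modular p (2^-1 *: f) <= 1)%E.
  by apply: (luxemburg_lt exp_p Lf); lra.
apply: luxemburg_le; first by rewrite divr_gt0.
rewrite invf_div (_ : (c / 2) *: f = c *: (2^-1 *: f)); last first.
  by rewrite (scalerA _ _ f).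
set g := 2^-1 *: f in f2 *.
have mg : measurable_fun I01 (g : R -> R) by exact: (measurable_fun_scale _ Lf.1).
have mpg := measurable_modular_integrand exp_p mg.
have mind : measurable_fun (I01 : set (measurableTypeR R))
    (fun t : R => (\1_A t)%:E : \bar R).
  by apply/measurable_EFinP; exact: measurable_indic.
apply: (@le_trans _ _
   (\int[mu]_(t in I01) ((a * b `^ P)%:E * (\1_A t)%:E +
      2^-1%:E * (`|g t| `^ p t)%:E))%E).
  apply: ge0_le_integral => //.
  - exact: (measurable_modular_integrand exp_q (measurable_fun_scale c mg)).
  - by apply: emeasurable_funD; exact: measurable_funeM.
  move=> t It; rewrite -!EFinM -EFinD lee_fin.
  have q1 : 1 <= q t by exact: exp_q.2.
  have q0 : 0 < q t by exact: lt_le_trans q1.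
  have qP : q t <= P by apply: (le_trans _ (pP t It)); have := gap t It; lra.
  have [gt0|gt0] := eqVneq (g t) 0.
    rewrite -[X in `|X|]/(c * g t) gt0 mulr0 normr0 !powR0 ?gt_eqF//.
      by rewrite mulr0 addr0 mulr_ge0// ltW.
    by have := gap t It; lra.
  have At : A t.
    split=> //; apply: contra_neq gt0 => ft0.
    by rewrite -[LHS]/(2^-1 * f t) ft0 mulr0.
  rewrite indicE mem_set// mulr1 normrZ gtr0_norm// powRM//; last exact: ltW.
  have cq : c `^ q t <= a by exact: ler_powR.
  have g0 : 0 < `|g t| by rewrite normr_gt0.
  have [gb|gb] := leP `|g t| b.
    rewrite (@le_trans _ _ (a * b `^ P))// ?lerDl ?mulr_ge0 ?powR_ge0//.
    rewrite ler_pM ?powR_ge0// (@le_trans _ _ (b `^ q t))//.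
      by apply: ge0_ler_powR; rewrite ?nnegrE// ltW.
    exact: ler_powR.
  rewrite (@le_trans _ _ (2^-1 * `|g t| `^ p t))//; last first.
    by rewrite lerDr ltW.
  rewrite -bd -mulrA ler_pM ?powR_ge0//.
  have -> : q t = p t - (p t - q t) by rewrite opprB addrC subrK.
  rewrite powRD; last by rewrite (gt_eqF g0) implybT.
  rewrite mulrC ler_wpM2r ?powR_ge0//.
  rewrite !powRN lef_pV2 ?posrE ?(powR_gt0 _ b0) ?(powR_gt0 _ g0)//.
  rewrite (@le_trans _ _ (`|g t| `^ delta))//.
    by apply: ge0_ler_powR; rewrite ?nnegrE ltW.
  apply: ler_powR; first exact: (le_trans b1 (ltW gb)).
  by have := gap t It; lra.
have nn1 (t : R) : I01 t -> (0 <= (a * b `^ P)%:E * (\1_A t)%:E)%E.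
  by move=> _; rewrite -EFinM lee_fin mulr_ge0 ?indicE// ltW.
have nn2 (t : R) : I01 t -> (0 <= 2^-1%:E * (`|g t| `^ p t)%:E)%E.
  by move=> _; rewrite -EFinM lee_fin mulr_ge0 ?powR_ge0.
rewrite (ge0_integralD _ mI nn1 _ nn2); [|exact: measurable_funeM..].
have i1 : (\int[mu]_(t in I01) ((a * b `^ P)%:E * (\1_A t)%:E) =
    (a * b `^ P)%:E * mu A)%E.
  rewrite ge0_integralZl_EFin//; last exact: ltW.
  rewrite integral_indic//; congr (_ * mu _)%E.
  by apply/setIidl => t [].
have i2 : (\int[mu]_(t in I01) (2^-1%:E * (`|g t| `^ p t)%:E) =
    2^-1%:E * modular p g)%E.
  by rewrite ge0_integralZl_EFin// => t _; rewrite lee_fin powR_ge0.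
rewrite i1 i2.
have Ab : ((a * b `^ P)%:E * mu A <= 2^-1%:E)%E.
  apply: (@le_trans _ _ ((a * b `^ P)%:E * (2^-1 / (a * b `^ P))%:E)%E).
    by apply: lee_wpmul2l => //; rewrite lee_fin ltW.
  by rewrite -EFinM lee_fin mulrC mulfVK// gt_eqF.
have gb : (2^-1%:E * modular p g <= 2^-1%:E)%E.
  by rewrite -[leRHS]mule1; apply: lee_wpmul2l => //; rewrite lee_fin.
apply: (le_trans (leeD Ab gb)).
by rewrite -EFinD lee_fin; lra.
Qed.

End Singular.

(** * The three conditions in the two cases *)
Section Conditions.
Context {R : realType}.
Implicit Types f g d : R -> R^o.
Local Notation mu := (@lebesgue_measure R).

Lemma luxemburg0_lt p (e : R) : exponent p -> 0 < e -> luxemburg p 0 < e.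
Proof.
move=> exp_p e0; apply: (@le_lt_trans _ _ (e / 2)); last lra.
apply: luxemburg_le; first by rewrite divr_gt0.
rewrite scaler0 /modular integral0_eq// => t It.
by rewrite normr0 powR0// gt_eqF// (lt_le_trans ltr01)//; exact: exp_p.2.
Qed.

Lemma closed_span_gen p (f : nat -> R -> R^o) n : exponent p ->
  Lvar p (f n) -> closed_linear_span (Lvar p) (luxemburg p) f (f n).
Proof.
move=> exp_p Lf; split=> // e e0; exists (f n).
  exists n.+1, (fun i => if i == n then 1 else 0).
  rewrite big_ord_recr /= eqxx (scale1r (f n)) big1 ?add0r// => i _.
  by rewrite (ltn_eqF (ltn_ord i)) (scale0r (f i)).
by rewrite subrr; exact: luxemburg0_lt.
Qed.

Lemma disjoint01_support f g : measurable_fun I01 (f : R -> R) ->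
  measurable_fun I01 (g : R -> R) -> disjoint01 f g ->
  mu ([set t | I01 t /\ f t != 0] `&` [set t | I01 t /\ g t != 0]) = 0%E.
Proof.
move=> mf mg [N [mN N0 fgN]]; apply/eqP; rewrite eq_le measure_ge0 andbT.
rewrite -[leRHS](N0 : mu (N `&` I01) = 0%E).
apply: le_measure; rewrite ?inE.
- by apply: measurableI; exact: measurable_support.
- exact: measurableI mN (@measurable_I01 R).
- move=> t [[It ft] [_ gt]]; split=> //; apply: fgN => /= m0.
  have : 0 < Num.min `|f t| `|g t| by rewrite lt_min !normr_gt0 ft.
  by rewrite m0 ltxx.
Qed.

(** On a normalised disjoint sequence the supports become small, hence so do
    the norms in the larger space, and the inclusion cannot be bounded below
    even on the members of the sequence. *)
Lemma gap_singular (p q : R -> R^o) (delta P : R) :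
  exponent p -> exponent q -> 0 < delta ->
  (forall t : R, I01 t -> q t + delta <= p t) ->
  (forall t : R, I01 t -> p t <= P) ->
  disjointly_strictly_singular (Lvar p) (luxemburg p) disjoint01
    (Lvar q) (luxemburg q) (idfun : {linear (R -> R^o) -> (R -> R^o)}).
Proof.
move=> exp_p exp_q d0 gap pP.
have le_qp (t : R) : I01 t -> q t <= p t.
  by move=> It; apply: (le_trans _ (gap t It)); rewrite lerDl ltW.
split.
  split=> [v Lv|]; first exact: (Lvar_mono exp_p exp_q le_qp Lv).
  by exists 2 => v Lv; exact: (luxemburg_le2 exp_p exp_q le_qp Lv).
move=> [f [f1 fd [c [C [c0 C0 fC]]]]].
(* With magnification [1 + 2 / c] the resulting bound [2 / (1 + 2 / c)] falls
   strictly below the lower constant [c] of the isomorphism. *)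
have k1 : 1 <= 1 + 2 / c by rewrite lerDl divr_ge0 ?ltW.
have [eta eta0 small] := gap_luxemburg_small exp_p exp_q d0 gap pP k1.
pose B n := [set t | I01 t /\ f n t != 0].
have mB n : measurable (B n : set (measurableTypeR R)).
  exact: measurable_support (f1 n).1.1.
have [||n Bn] := ae_disjoint_small mB _ _ eta0.
- by move=> n t [].
- by move=> m n mn; exact: (disjoint01_support (f1 m).1.1 (f1 n).1.1 (fd _ _ mn)).
have := small _ (f1 n).1; rewrite (f1 n).2 => /(_ (lexx _) Bn).
have /andP[+ _] := fC _ (closed_span_gen exp_p (f1 n).1).
rewrite (f1 n).2 mulr1 => /le_trans h /h.
apply/negP; rewrite -ltNge ltr_pdivrMr ?(lt_le_trans ltr01)//.
by rewrite mulrDr mulr1 mulrCA mulfV ?gt_eqF// mulr1 ltrDr.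
Qed.

Lemma log_holder_continuous f : log_holder f ->
  {within `[0, 1], continuous (f : R -> R)}.
Proof.
move=> [C C0 fC]; apply/subspace_continuousP => x Ix.
apply/cvgrPdist_lt => e e0; rewrite near_withinE.
have eta0 : 0 < expR (- (C / e)) :> R by exact: expR_gt0.
near=> t => It; have [->|xt] := eqVneq x t; first by rewrite subrr normr0.
apply: (le_lt_trans (fC _ _ Ix It xt)).
have xt0 : 0 < `|x - t| by rewrite normr_gt0 subr_eq0.
have ltL : C / e < ln (expR 1 + 1 / `|x - t|).
  rewrite -[ltLHS]expRK ltr_ln ?posrE ?expR_gt0 ?addr_gt0 ?expR_gt0 ?divr_gt0//.
  rewrite (@lt_trans _ _ (1 / `|x - t|))// ?ltrDr ?expR_gt0//.
  rewrite div1r -[ltLHS]invrK ltf_pV2 ?posrE ?invr_gt0 ?expR_gt0// -expRN.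
  near: t; apply: nbhsx_ballx => //.
rewrite ltr_pdivrMr; last by apply: lt_trans ltL; rewrite divr_gt0.
by rewrite mulrC -ltr_pdivrMr.
Unshelve. all: by end_near. Qed.

Lemma log_holder_bounded f : log_holder f ->
  exists P : R, forall t : R, I01 t -> f t <= P.
Proof.
move=> /log_holder_continuous /(EVT_max ler01)[c _ fc].
by exists (f c) => t It; apply: fc; exact/I01E.
Qed.

Lemma log_holder_zero_or_gap d : log_holder d ->
  (forall t : R, I01 t -> 0 <= d t) ->
  (exists2 x0 : R, I01 x0 & d x0 = 0) \/
  (exists2 delta : R, 0 < delta & forall t : R, I01 t -> delta <= d t).
Proof.
move=> /log_holder_continuous /(EVT_min ler01)[c Ic dc] d0.
have [dc0|dc0] := eqVneq (d c) 0; first by left; exists c.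
right; exists (d c); last by move=> t It; apply: dc; exact/I01E.
by rewrite lt_def dc0 d0//; exact/I01E.
Qed.

Lemma gap_ess_inf d (delta : R) : 0 < delta ->
  (forall t : R, I01 t -> delta <= d t) ->
  (0 < ess_inf leb01 (fun t : R => (d t)%:E))%E.
Proof.
move=> d0 gap; apply: (@lt_le_trans _ _ delta%:E); first by rewrite lte_fin.
apply/ess_infP.
exists (~` I01); split.
- by apply: measurableC; exact: (@measurable_I01 R).
- have : mu (~` I01 `&` I01) = 0%E by rewrite setICl measure0.
  exact.
- by move=> t /= nd It; apply: nd; rewrite lee_fin; exact: gap.
Qed.

(** Near the zero, [d] lies below any given [delta] on a shell, which has
    positive measure. *)
Lemma zero_ess_inf d (x0 M : R) : I01 x0 -> 0 < M ->
  (forall h t : R, 0 < h < 1 -> I01 t -> `|t - x0| <= 2 * h ->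
    `|d t| <= M / ln h^-1) ->
  ~ (0 < ess_inf leb01 (fun t : R => (d t)%:E))%E.
Proof.
move=> Ix0 M0 decay inf0.
have [delta delta0 dinf] : exists2 delta : R, 0 < delta &
    (delta%:E <= ess_inf leb01 (fun t : R => (d t)%:E))%E.
  case: (ess_inf _ _) inf0 => [r| |]//; first by exists r.
  by exists 1 => //; rewrite leey.
have [N [mN N0 dN]] : \forall t \ae leb01, (delta%:E <= (d t)%:E)%E.
  exact/ess_infP.
(* The summand 2 makes [h] at most 1/4 (as [expR 1 >= 2]) and, at the same
   time, makes [M / ln h^-1 < delta] strict. *)
pose h : R := expR (- (M / delta + 2)).
have h0 : 0 < h by exact: expR_gt0.
have md0 : 0 < M / delta by rewrite divr_gt0.
have h4 : h <= 4^-1.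
  rewrite /h expRN lef_pV2 ?posrE ?expR_gt0//.
  apply: (@le_trans _ _ (expR 2)); last by rewrite ler_expR lerDr ltW.
  have -> : 2 = 1 + 1 :> R by [].
  by rewrite expRD; have := @expR1_ge2 R; nra.
have h1 : 0 < h < 1 by rewrite h0 (le_lt_trans h4)//; lra.
have lnh : ln h^-1 = M / delta + 2 by rewrite /h expRN invrK expRK.
have : (mu (shell x0 h) <= mu (N `&` I01))%E.
  apply: le_measure; rewrite ?inE.
  - exact: measurable_shell.
  - exact: measurableI mN (@measurable_I01 R).
  move=> t At; have It := shell_I01 Ix0 (introT andP (conj h0 h4)) At.
  split=> //; apply: dN => /=; rewrite lee_fin.
  have /andP[_ tx] := shell_dist h0 At.
  have := decay h t h1 It tx; rewrite lnh => dt.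
  apply/negP; rewrite -ltNge; apply: (le_lt_trans (le_trans (ler_norm _) dt)).
  rewrite ltr_pdivrMr ?addr_gt0// mulrDr mulrCA mulfV ?gt_eqF// mulr1.
  by rewrite ltrDl mulr_gt0.
rewrite [X in (_ <= X)%E]N0 lebesgue_shell// lee_fin.
by rewrite leNgt h0.
Qed.

(** The bound [P] provides an admissible level for the rearrangement; without
    one the real infimum would be taken over the empty set, and be 0. *)
Lemma gap_rearrangement_ge d (delta P x : R) :
  (forall t : R, I01 t -> delta <= d t) ->
  (forall t : R, I01 t -> `|d t| <= P) -> 0 <= x < 1 ->
  delta <= rearrangement d x.
Proof.
move=> gap dP /andP[x0 x1]; apply: lb_le_inf.
  exists P; split.
    by rewrite (le_trans (normr_ge0 (d 0)))// dP//; apply/I01E; lra.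
  rewrite (_ : [set _ | _] = set0) ?measure0 ?lee_fin//.
  by apply/seteqP; split=> // t [It]; rewrite ltNge dP.
move=> s [s0 sx]; rewrite leNgt; apply/negP => sd; move: sx.
rewrite (_ : [set _ | _] = I01); last first.
  apply/seteqP; split=> [t []//|t It]; split=> //.
  exact: lt_le_trans (lt_le_trans sd (gap t It)) (ler_norm _).
by rewrite [leLHS]lebesgue_I01 lee_fin leNgt x1.
Qed.

Lemma gap_cvg d (delta P : R) : 0 < delta ->
  (forall t : R, I01 t -> delta <= d t) ->
  (forall t : R, I01 t -> `|d t| <= P) ->
  (fun x : R => (1 - x) `^ rearrangement d x) @ 1^'- --> (0 : R).
Proof.
move=> d0 gap dP; apply/cvgr0Pnorm_lt => e e0.
have r0 : 0 < e `^ delta^-1 by exact: powR_gt0.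
have r1 : 1 - e `^ delta^-1 < 1 by rewrite ltrBlDr ltrDl.
near=> x.
have x1 : x < 1 by near: x; exact: nbhs_left_lt.
have x0 : 0 < x by near: x; exact: nbhs_left_gt.
have xe : 1 - e `^ delta^-1 < x by near: x; exact: nbhs_left_gt.
have xd : delta <= rearrangement d x.
  by apply: gap_rearrangement_ge dP _ => //; rewrite (ltW x0).
rewrite ger0_norm ?powR_ge0//.
apply: (@le_lt_trans _ _ ((1 - x) `^ delta)).
  by apply: ger_powR => //; rewrite subr_gt0 x1 gerBl ltW.
have -> : e = (e `^ delta^-1) `^ delta.
  by rewrite -powRrM mulVf ?gt_eqF// powRr1// ltW.
apply: gt0_ltr_powR => //; rewrite ?nnegrE ?subr_ge0 ?(ltW x1)// ?(ltW r0)//.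
by rewrite ltrBlDr -ltrBlDl.
Unshelve. all: by end_near. Qed.

(** The shell of radius [h = 1 - x] has measure [h], and [d] is at most
    [M / ln h^-1] on it, so this number is an admissible level for the
    rearrangement at [x].  Raising [h] to it gives exactly [expR (- M)], a lower
    bound that does not depend on [x]. *)
Lemma zero_not_cvg d (x0 M : R) : measurable_fun I01 (d : R -> R) ->
  I01 x0 -> 0 < M ->
  (forall h t : R, 0 < h < 1 -> I01 t -> `|t - x0| <= 2 * h ->
    `|d t| <= M / ln h^-1) ->
  ~ ((fun x : R => (1 - x) `^ rearrangement d x) @ 1^'- --> (0 : R)).
Proof.
move=> md Ix0 M0 decay /cvgr0Pnorm_lt /(_ _ (expR_gt0 (- M))) small.
have [x [xs x34 x1]] : exists x : R,
    [/\ `|(1 - x) `^ rearrangement d x| < expR (- M), 3 / 4 <= x & x < 1].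
  apply: (@filter_ex _ (1^'- : set_system R)).
  near=> x; split; first by near: x.
    by near: x; apply: nbhs_left_ge; lra.
  by near: x; exact: nbhs_left_lt.
pose h := 1 - x; have h0 : 0 < h by rewrite subr_gt0.
have h4 : h <= 4^-1 by rewrite /h; lra.
have h1 : 0 < h < 1 by rewrite h0 (le_lt_trans h4)//; lra.
have lnh : 0 < ln h^-1 by rewrite ln_gt0// invf_gt1//; case/andP: h1.
have rM : rearrangement d x <= M / ln h^-1.
  apply: ge_inf; first by exists 0 => s [].
  split; first by rewrite divr_ge0 ?ltW.
  set S := [set _ | _].
  have mS : measurable (S : set (measurableTypeR R)).
    rewrite (_ : S = I01 `&` (fun t => `|d t|) @^-1` `]M / ln h^-1, +oo[%classic).
      by apply: (measurableT_comp _ md) => //; exact: measurable_I01.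
    by apply/seteqP; split=> t [It] /=; rewrite in_itv/= andbT.
  have hI := shell_I01 Ix0 (introT andP (conj h0 h4)).
  have mA := measurable_shell x0 h.
  have mI := @measurable_I01 R.
  apply: (@le_trans _ _ (mu (I01 `\` shell x0 h))).
    apply: le_measure; rewrite ?inE//; first exact: measurableD.
    move=> t [It dt]; split=> // At.
    have /andP[_ tx] := shell_dist h0 At.
    by move: dt; rewrite ltNge decay.
  have : mu I01 = (mu (I01 `\` shell x0 h) + mu (I01 `&` shell x0 h))%E.
    exact: measureDI.
  rewrite lebesgue_I01 (setIidr hI) lebesgue_shell//.
  case: (mu _) => [r| |]//; rewrite -EFinD => -[] rE.
  by rewrite lee_fin; move: rE; rewrite /h; lra.
move: xs; rewrite -/h ger0_norm ?powR_ge0//; apply/negP; rewrite -leNgt.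
apply: (@le_trans _ _ (h `^ (M / ln h^-1))); last first.
  by apply: ger_powR => //; rewrite h0 (le_trans h4)//; lra.
rewrite /powR gt_eqF// lnV ?posrE// invrN mulrN mulNr mulfVK// lt_eqF//.
by rewrite -oppr_gt0 -lnV.
Unshelve. all: by end_near. Qed.

End Conditions.

Theorem corollary5p3 (R : realType) (p q : R -> R^o)
    (exp_p : exponent p) (exp_q : exponent q)
    (lh_p : log_holder p) (lh_q : log_holder q)
    (le_qp : forall t : R, I01 t -> q t <= p t)
    (p_fin : (ess_sup leb01 (fun t : R => (p t)%:E) < +oo)%E) :
  let cond1 := (0 < ess_inf leb01 (fun t : R => (p t - q t)%:E))%E in
  let cond2 := disjointly_strictly_singular (Lvar p) (luxemburg p) disjoint01
    (Lvar q) (luxemburg q) (idfun : {linear (R -> R^o) -> (R -> R^o)}) in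
  let cond3 := (fun x : R => (1 - x) `^ rearrangement (p \- q) x)
    @ 1^'- --> (0 : R) in
  (cond1 <-> cond2) /\ (cond2 <-> cond3).
Proof.
move=> cond1 cond2 cond3.
have lh_d : log_holder (p \- q) by exact: log_holderB.
have d0 (t : R) : I01 t -> 0 <= (p \- q) t.
  by move=> It; rewrite subr_ge0; exact: le_qp.
have [[x0 Ix0 dx0]|[delta delta0 gap]] := log_holder_zero_or_gap lh_d d0.
  have [M M0 decay] := log_holder_zero_decay lh_d Ix0 dx0.
  have n1 : ~ cond1 by exact: (@zero_ess_inf _ (p \- q) _ _ Ix0 M0 decay).
  have n2 : ~ cond2 by exact: (shell_not_singular exp_p exp_q le_qp Ix0 M0 decay).
  have n3 : ~ cond3.
    apply: (zero_not_cvg _ Ix0 M0 decay).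
    exact: measurable_funB exp_p.1 exp_q.1.
  by split; split=> c; [case: (n1 c)|case: (n2 c)|case: (n2 c)|case: (n3 c)].
have [P pP] := log_holder_bounded lh_p.
have c1 : cond1 by exact: (@gap_ess_inf _ (p \- q) _ delta0 gap).
have c2 : cond2.
  apply: (gap_singular exp_p exp_q delta0 _ pP) => t It.
  by rewrite -lerBrDl; exact: gap.
have c3 : cond3.
  apply: (gap_cvg delta0 gap (P := P)) => t It.
  rewrite ger0_norm ?d0// (le_trans _ (pP t It))// gerBl.
  exact: le_trans ler01 (exp_q.2 t It).
by [].
Qed.
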